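(* Let $d\ge 2$ and $r\in\mathbb{N}\setminus\{1,2,4\}$. A shift-invariant Markov cocycle $M$ on $X_r$ is a Gibbs cocycle corresponding to a shift-invariant nearest neighbor interaction if and only if it is of the form $M=\sum_{i=0}^{r-1}\alpha_iM_i$ with $\sum_{i=0}^{r-1}\alpha_i=0$, where $\alpha_i=M(x^{(i)},y^{(i)})$. In other words, $$\mathcal{G}^\sigma_{X_r}=\Big\{\sum_{i=0}^{r-1}\alpha_iM_i~:~\sum_{i=0}^{r-1}\alpha_i=0\Big\}.$$ In particular, $\dim(\mathcal{G}^\sigma_{X_r})=r-1$.
   Context: $\mathbb{Z}^d$ is regarded as the vertex set of the graph in which $n,m$ are adjacent iff $\|n-m\|_1=1$. For $F\subset\mathbb{Z}^d$, $\partial F$ is the set of sites outside $F$ adjacent to some site of $F$. The shift action is $(\sigma_n x)_m=x_{m+n}$. $Ht=\{\hat x\in\mathbb{Z}^{\mathbb{Z}^d}: |\hat x_n-\hat x_m|=1 \text{ whenever } \|n-m\|_1=1\}$; $\phi_r:Ht\to(\mathbb{Z}_r)^{\mathbb{Z}^d}$, $\mathbb{Z}_r=\mathbb{Z}/r\mathbb{Z}$, is coordinatewise reduction modulo $r$; and $X_r=\phi_r(Ht)$. For $X=X_r$ or $X=Ht$, $\Delta_X$ is the set of pairs $(x,y)\in X\times X$ with $x_n=y_n$ for all but finitely many $n$. Every $(x,y)\in\Delta_{X_r}$ is the image under $\phi_r$ of some $(\hat x,\hat y)\in\Delta_{Ht}$, with all $\hat x_n-\hat y_n$ even. For $i\in\mathbb{Z}_r$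 and integers $a,b$ with $a-b$ even, $N_i(a,b)=|\{m\in(2\mathbb{Z}+a)\cap(r\mathbb{Z}+i): m\in[a,b)\}|$ if $a\le b$, and $N_i(a,b)=-N_i(b,a)$ otherwise. For $i=0,\dots,r-1$, $M_i(x,y)=\sum_{n\in\mathbb{Z}^d}N_i(\hat x_n,\hat y_n)$ where $(\hat x,\hat y)\in\Delta_{Ht}$ is any pair mapped to $(x,y)$ by $\phi_r$ (the value does not depend on the choice). For $i=0,\dots,r-1$, $(x^{(i)},y^{(i)})\in\Delta_{X_r}$ is a pair with $x^{(i)}_0=i$, $y^{(i)}_0=i+2 \bmod r$ and $x^{(i)}_n=y^{(i)}_n$ for all $n\neq 0$. A $\Delta_X$-cocycle is a function $M:\Delta_X\to\mathbb{R}$ with $M(x,z)=M(x,y)+M(y,z)$ whenever $(x,y),(y,z)\in\Delta_X$. It is a Markov cocycle if, for every finite $F$ and all $(x,y)\in\Delta_X$ with $x|_{F^c}=y|_{F^c}$, $M(x,y)$ is determined by $x|_{F\cup\partial F}$ and $y|_{F\cup\partial F}$. It is shift-invariant if $M(\sigma_n x,\sigma_n y)=M(x,y)$ for all $n$. $\mathcal{B}(X)$ is the set of all patterns $x|_W$, $x\in X$, $W\subset\mathbb{Z}^d$ finite. A nearest neighbor interaction on $X$ is a function $\phi:\mathcal{B}(X)\to\mathbb{R}$ with $\phi(a)=0$ whenever the set on which $a$ is defined has diameter greater than $1$; it is shift-invariant if it takes the same value on a pattern and all its translates. The associated Gibbs cocycle is $M_\phi(x,y)=\sum_{W\text{ finite}}\big(\phi(y|_W)-\phi(x|_W)\big)$.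 $\mathcal{G}^\sigma_X$ is the space of all $M_\phi$ with $\phi$ a shift-invariant nearest neighbor interaction on $X$. *)

(* Defs.v *)
From HB Require Import structures.
From mathcomp Require Import all_boot all_order all_algebra finmap.
From mathcomp Require Import zify.
From mathcomp Require Import all_classical all_reals.

Set Implicit Arguments.
Unset Strict Implicit.
Unset Printing Implicit Defensive.

Import Order.TTheory GRing.Theory Num.Theory.
Local Open Scope classical_set_scope.
Local Open Scope ring_scope.

Notation site d := 'rV[int]_d.

Section Lattice.
Variable d : nat.
Implicit Types (n m : site d) (W : {fset site d}).

Definition norm1 n : nat := (\sum_(k < d) `|n 0%R k|)%N.

Definition adjacent n m : Prop := norm1 (n - m) = 1%N.

Definition boundary (F : set (site d)) : set (site d) :=
  [set n | ~ F n /\ exists2 m, F m & adjacent n m].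

Definition diam W : nat := \max_(n <- W) \max_(m <- W) norm1 (n - m).

End Lattice.

Section Subshift.
Variables (d : nat) (A : Type).
Implicit Types (x y : site d -> A) (X : set (site d -> A)).

Definition shift (k : site d) x : site d -> A := fun m => x (m + k).

Definition Delta X : set ((site d -> A) * (site d -> A)) :=
  [set p | [/\ X p.1, X p.2 & finite_set [set n | p.1 n <> p.2 n]]].

Definition restr x (W : {fset site d}) : {fmap site d -> A} :=
  [fmap n : W => x (val n)].

Definition language X : set {fmap site d -> A} :=
  [set a | exists2 x, X x & exists W, a = restr x W].

Lemma language_restr X x W : X x -> restr x W \in language X.
Proof. by move=> Xx; rewrite inE; exists x => //; exists W. Qed.

Lemma Delta_fst X (p : Delta X) : X (val p).1.
Proof. by case: (set_mem (valP p)). Qed.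

Lemma Delta_snd X (p : Delta X) : X (val p).2.
Proof. by case: (set_mem (valP p)). Qed.

Definition pattern_fst X (p : Delta X) W : language X :=
  exist _ (restr (val p).1 W) (language_restr W (Delta_fst p)).
Definition pattern_snd X (p : Delta X) W : language X :=
  exist _ (restr (val p).2 W) (language_restr W (Delta_snd p)).

Variables (R : realType) (X : set (site d -> A)).

(* R^o rather than R, so that functions to it form an R-module. *)
Implicit Types (M : Delta X -> R^o) (phi : language X -> R).

Definition is_cocycle M : Prop := forall p q s : Delta X,
  (val p).2 = (val q).1 -> (val s).1 = (val p).1 -> (val s).2 = (val q).2 ->
  M s = M p + M q.

Definition is_markov M : Prop := forall F : set (site d), finite_set F ->
  forall p q : Delta X,
    (forall n, ~ F n -> (val p).1 n = (val p).2 n) ->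
    (forall n, ~ F n -> (val q).1 n = (val q).2 n) ->
    (forall n, (F `|` boundary F) n -> (val p).1 n = (val q).1 n) ->
    (forall n, (F `|` boundary F) n -> (val p).2 n = (val q).2 n) ->
  M p = M q.

Definition is_shift_invariant M : Prop := forall (k : site d) (p q : Delta X),
  (val q).1 = shift k (val p).1 -> (val q).2 = shift k (val p).2 -> M q = M p.

Definition shift_invariant_markov_cocycle M : Prop :=
  [/\ is_cocycle M, is_markov M & is_shift_invariant M].

Definition nearest_neighbor phi : Prop :=
  forall a : language X, (1 < diam (domf (val a)))%N -> phi a = 0.

(* The hypothesis on a and b says that b is the translate of a by - k,
   domains included, since .[? _ ] is None off the domain. *)
Definition shift_invariant_interaction phi : Prop :=
  forall (k : site d) (a b : language X),
    (forall n, (val b).[? n]%fmap = (val a).[? n + k]%fmap) -> phi b = phi a.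

(* For a nearest neighbor phi only finitely many terms are nonzero; \sum_(_ \in _)
   is the sum over the support, when the support is finite. *)
Definition gibbs_cocycle phi : Delta X -> R^o := fun p =>
  \sum_(W \in [set: {fset site d}])
    (phi (pattern_snd p W) - phi (pattern_fst p W)).

Definition Gsigma : set (Delta X -> R^o) :=
  [set gibbs_cocycle phi | phi in
    [set phi | nearest_neighbor phi /\ shift_invariant_interaction phi]].

End Subshift.

Arguments Gsigma {d A} R X.

Section HeightFunctions.
Variable d : nat.

Definition Ht : set (site d -> int) :=
  [set x | forall n m, adjacent n m -> `|x n - x m| = 1].

(* 'Z_r is Z/rZ only for r > 1. *)
Definition phi_mod (r : nat) (x : site d -> int) : site d -> 'Z_r :=
  fun n => (x n)%:~R.
Arguments phi_mod : clear implicits.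

Definition Xmod (r : nat) : set (site d -> 'Z_r) := phi_mod r @` Ht.
Arguments Xmod : clear implicits.

Definition Nle (r i : nat) (a b : int) : nat :=
  #|` fset_set [set m : int | [/\ a <= m < b,
        (m = a %[mod 2])%Z & (m = i %[mod r])%Z]] |%fset.

(* Only meaningful when a - b is even. *)
Definition Ncount (r i : nat) (a b : int) : int :=
  if a <= b then (Nle r i a b)%:Z else - (Nle r i b a)%:Z.

Definition is_lift (r : nat) (p : Delta (Xmod r)) :
    set ((site d -> int) * (site d -> int)) :=
  [set q | [/\ Delta Ht q, phi_mod r q.1 = (val p).1 &
               phi_mod r q.2 = (val p).2]].

(* For d >= 2 and r outside {1, 2, 4}, lifts exist, and Mcoc does not depend on
   the chosen one. Heights in a lift differ by even numbers automatically. *)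
Definition lift (r : nat) (p : Delta (Xmod r)) :
    (site d -> int) * (site d -> int) :=
  xget (fun=> 0, fun=> 0) (is_lift p).

Definition Mcoc (R : realType) (r i : nat) : Delta (Xmod r) -> R^o := fun p =>
  \sum_(n \in [set: site d])
    ((Ncount r i ((lift p).1 n) ((lift p).2 n))%:~R : R).

Definition is_flip_pair (r i : nat) (p : Delta (Xmod r)) : Prop :=
  [/\ (val p).1 0 = i%:R, (val p).2 0 = (i + 2)%:R &
      forall n, n != 0 -> (val p).1 n = (val p).2 n].

End HeightFunctions.

Arguments phi_mod : clear implicits.
Arguments Xmod : clear implicits.
Arguments Mcoc d R r i : clear implicits.

Definition has_dim (K : fieldType) (V : lmodType K) (S : set V) (n : nat) : Prop :=
  exists b : 'I_n -> V,
    (forall c : 'I_n -> K, \sum_(j < n) c j *: b j = 0 -> forall j, c j = 0) /\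
    S = [set \sum_(j < n) c j *: b j | c in [set: 'I_n -> K]].

Lemma odd_norm1D d (n m : site d) :
  odd (norm1 (n + m)) = odd (norm1 n) (+) odd (norm1 m).
Proof.
rewrite /norm1 -oddD -big_split /= !(big_morph _ oddD (erefl : odd 0 = false)).
apply: eq_bigr => k _; rewrite mxE.
by move: (n _ k) (m _ k) => [a|a] [b|b]; lia.
Qed.

(* The hypothesis on flip pairs in the theorem is satisfiable: take heights
   i and i + 1 on the even and odd sublattices, and raise the origin by 2. *)
Lemma flip_pair_exists d (r i : nat) :
  exists p : Delta (Xmod d r), is_flip_pair i p.
Proof.
pose x (n : site d) : int := (i + odd (norm1 n))%:Z.
pose y (n : site d) : int := if n == 0 then (i + 2)%:Z else x n.
have norm0 : norm1 (0 : site d) = 0%N.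
  by rewrite /norm1 big1 // => k _; rewrite mxE.
have odd_adj (n m : site d) : adjacent n m -> odd (norm1 n) = ~~ odd (norm1 m).
  by move=> h; rewrite -(subrK m n) odd_norm1D h.
have Htx : Ht x.
  by move=> n m /odd_adj; rewrite /x => ->; case: (odd _) => /=; lia.
have Hty : Ht y.
  move=> n m nm; have := Htx n m nm; have := odd_adj n m nm; rewrite /y.
  case: eqVneq => [->|_]; case: eqVneq => [->|_] //; rewrite /x norm0 /=.
  - by [].
  - by case: (odd _) => //= _ _; lia.
  - by move=> -> _; lia.
have Dp : (phi_mod d r x, phi_mod d r y) \in Delta (Xmod d r).
  rewrite inE; split => /=; [by exists x | by exists y |].
  apply: (sub_finite_set _ (finite_set1 (0 : site d))) => n /= nxy.
  apply/eqP; apply: contra_notT nxy => n0.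
  by rewrite /phi_mod /y (negbTE n0).
exists (exist _ (phi_mod d r x, phi_mod d r y) Dp); split => /=.
- by rewrite /phi_mod /x norm0 addn0.
- by rewrite /phi_mod /y eqxx.
- by move=> n n0; rewrite /phi_mod /y (negbTE n0).
Qed.

(* Main.v *)
Require Import Defs.
From mathcomp Require Import all_boot all_order all_algebra finmap.
From mathcomp Require Import zify ring.
From mathcomp Require Import all_classical all_reals.

(** Lift both configurations of a pair to integer height functions [X] and [Y]
    that differ at finitely many sites only ([lift_spec]).  A nearest neighbour
    interaction that is shift-invariant amounts to an energy [f] of symbols and
    energies [g k] of the two symbols at the ends of an edge along axis [k]
    ([site_symbol], [edge_symbol]).  The edges of the integer line contain no
    cycle, so on heights [g k a b] splits as [u k a + v k b] ([height_split]).
    After a translation of the second part, the Gibbs cocycle becomes the sum over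
    sites of [H (Y n) - H (X n)] for one potential [H] on the integers.  The
    potential itself need not be periodic, but [H (m + 2) - H m] is a function
    [alpha] of the residue of [m], because it is a sum of differences of values of
    [f] and [g]; and counting the residues met while climbing by steps of 2 from
    [X n] to [Y n] turns the sum into the combination of the [Mcoc] with
    coefficients [alpha] ([sum_Ncount], [gibbs_cocycle_Mcoc]).  The same formula
    for [alpha] shows that its sum over a period is zero ([sum_flip_energy]).

    Conversely, coefficients with zero sum are the increments [s (v + 1) - s v] of
    a function of residues ([cyclic_primitive]), and the interaction that gives
    energy [s v] to the edges along one fixed axis that rise from [v] to [v + 1]
    has exactly these coefficients.

    Finally the [Mcoc] are dual to the flip pairs ([Mcoc_flip]): they are
    linearly independent, the coefficients are the values on flip pairs, and
    the coefficient vectors with zero sum form a space of dimension [r - 1]. *)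

Set Implicit Arguments.
Unset Strict Implicit.
Unset Printing Implicit Defensive.

Import Order.TTheory GRing.Theory Num.Theory.
Local Open Scope classical_set_scope.
Local Open Scope ring_scope.

(** * Residues and integers *)

Lemma natZr_eq0 (r n : nat) : (1 < r)%N ->
  (n%:R == 0 :> 'Z_r) = (r %| n)%N.
Proof. by move=> r1; rewrite -val_eqE /= val_Zp_nat. Qed.

Lemma intZr_eq (r : nat) (a b : int) : (1 < r)%N ->
  (a%:~R = b%:~R :> 'Z_r) <-> (r %| a - b)%Z.
Proof.
move=> r1; have int0 (z : int) : (z%:~R == 0 :> 'Z_r) = (r %| z)%Z.
  rewrite dvdzE /= -natZr_eq0 //; case: z => n //=.
  by rewrite NegzE rmorphN /= oppr_eq0.
by rewrite -int0 rmorphB /= subr_eq0; split=> [->|/eqP].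
Qed.

Lemma int_step_const T (h : int -> T) : (forall t, h (t + 1) = h t) ->
  forall s t, h s = h t.
Proof.
move=> hS; suff h0 t : h t = h 0 by move=> s t; rewrite !h0.
elim/int_rect: t => // n <-; first by rewrite -(hS n%:Z); congr h; lia.
by rewrite -(hS (- n.+1%:Z)); congr h; lia.
Qed.

Lemma dvdz_small (r : nat) (z : int) : (r %| z)%Z -> (`|z| < r)%N -> z = 0.
Proof.
rewrite dvdzE /= => rz zr; apply/eqP; rewrite -absz_eq0 -leqn0 leqNgt.
by apply/negP=> /dvdn_leq/(_ rz); rewrite leqNgt zr.
Qed.

(** * Lines and boxes in the lattice *)

Section Lattice.
Variable d : nat.
Implicit Types (n m z : site d) (k l : 'I_d).

Definition axis k : site d := delta_mx 0 k.

Definition setc n k (t : int) : site d :=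
  \row_j (if j == k then t else n 0 j).

Lemma setc_id n k : setc n k (n 0 k) = n.
Proof. by apply/rowP=> j; rewrite mxE; case: eqP => [->|]. Qed.

Lemma setc_succ n k t : setc n k (t + 1) = setc n k t + axis k.
Proof. by apply/rowP=> j; rewrite !mxE eqxx /=; case: eqP => _; rewrite ?addr0. Qed.

Lemma norm1N n : norm1 (- n) = norm1 n.
Proof. by apply: eq_bigr => k _; rewrite mxE abszN. Qed.

Lemma norm1_axis k : norm1 (axis k) = 1%N.
Proof.
rewrite /norm1 (bigD1 k) //= mxE !eqxx big1 // => j jk.
by rewrite mxE (negbTE jk) andbF.
Qed.

Lemma norm1_eq0 n : norm1 n = 0%N -> n = 0.
Proof.
move/eqP; rewrite sum_nat_eq0 => /forallP n0; apply/rowP=> k; rewrite mxE.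
by have := n0 k; rewrite implyTb absz_eq0 => /eqP.
Qed.

Lemma adjacentC n m : adjacent n m -> adjacent m n.
Proof. by rewrite /adjacent -norm1N opprB. Qed.

Lemma adjacent_axis n k : adjacent (n + axis k) n.
Proof. by rewrite /adjacent addrC addKr norm1_axis. Qed.

Lemma norm1_eq1 z : norm1 z = 1%N -> exists k, z = axis k \/ z = - axis k.
Proof.
move=> z1.
have [k zk] : exists k, `|z 0%R k|%N != 0%N.
  case: (pickP (fun k => `|z 0%R k|%N != 0%N)) => [k ?|z0]; first by exists k.
  by move: z1; rewrite /norm1 big1 // => k _; apply/eqP/negPn; rewrite z0.
move: z1; rewrite /norm1 (bigD1 k) //= => z1.
have zk1 : `|z 0%R k|%N = 1%N by lia.
have z0 j : j != k -> z 0 j = 0.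
  move=> jk; move: z1; rewrite zk1 add1n => -[] /eqP.
  by rewrite sum_nat_eq0 => /forallP/(_ j); rewrite jk absz_eq0 => /eqP.
exists k; have [zk0|zk0] := ltrP 0 (z 0 k); [left|right]; apply/rowP=> j;
  rewrite !mxE eqxx /=; have [->|/z0->//] := eqVneq j k;
  by move: zk1 zk0; lia.
Qed.

Lemma adjacentP n m : adjacent n m ->
  exists k, n = m + axis k \/ m = n + axis k.
Proof.
move=> /norm1_eq1[k [nm|nm]]; exists k; [left|right].
  by rewrite -nm addrC subrK.
by rewrite -[axis k]opprK -nm opprB addrC subrK.
Qed.

(** Connectivity is only ever used along full lines: by choosing a line that
    avoids a forbidden set, one never has to handle general lattice paths. *)
Lemma line_const T (c : site d -> T) n k :
  (forall t, c (setc n k t + axis k) = c (setc n k t)) ->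
  forall t, c (setc n k t) = c n.
Proof.
move=> cS t; rewrite -[in RHS](setc_id n k).
by apply: (int_step_const (h := fun t => c (setc n k t))) => s; rewrite setc_succ.
Qed.

Lemma finite_bounded (D : set (site d)) : finite_set D ->
  exists B : nat, forall n, D n -> forall k, (`|n 0%R k| <= B)%N.
Proof.
move=> /finite_fsetP[E ->]; exists (\sum_(n <- E) norm1 n)%N => n /= nE k.
rewrite (big_rem n) //= /norm1 (bigD1 k) //=; lia.
Qed.

Lemma finite_box (B : nat) :
  finite_set [set n : site d | forall k, (`|n 0%R k| <= B)%N].
Proof.
pose f (g : {ffun 'I_d -> 'I_(B.*2.+1)}) : site d := \row_k ((g k)%:Z - B%:Z).
apply: (@sub_finite_set _ _ (f @` [set: _])); last exact/finite_image/finite_finset.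
move=> n /= nB; exists [ffun k => inord `|(n 0%R k + B%:Z)%R|%N] => //.
apply/rowP=> k; rewrite mxE ffunE inordK; have := nB k; lia.
Qed.

Lemma finite_escape (D : set (site d)) n k : finite_set D ->
  exists t, ~ D (setc n k t).
Proof.
move=> /finite_bounded[B DB]; exists B.+1%:Z => /DB/(_ k).
by rewrite mxE eqxx; lia.
Qed.

Lemma other_axis k : (2 <= d)%N -> exists l, k != l.
Proof.
move=> d2; case: (pickP (fun l => k != l)) => [l ?|H]; first by exists l.
have := H (Ordinal (leq_trans (leqnSn 1) d2)); have := H (Ordinal d2).
by move/negbFE/eqP=> -> /negbFE/eqP/(congr1 val).
Qed.

(** The complement of a box is connected when there are at least two axes.  A
    site off the box has some coordinate [k] out of range; the other coordinates
    can be changed freely without entering the box, in particular moved out of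
    range themselves, after which coordinate [k] is free as well. *)
Lemma const_off_finite T (c : site d -> T) (D : set (site d)) : (2 <= d)%N ->
  finite_set D ->
  (forall n k, ~ D n -> ~ D (n + axis k) -> c (n + axis k) = c n) ->
  exists v, finite_set [set n | c n <> v].
Proof.
move=> d2 Dfin cS; have [B DB] := finite_bounded Dfin.
have lineD n k l t : k != l -> (B < `|n 0%R k|)%N -> c (setc n l t) = c n.
  move=> kl nk; have off s : ~ D (setc n l s).
    by move=> /DB/(_ k); rewrite mxE (negbTE kl); lia.
  by apply: line_const => s; apply: cS => //; rewrite -setc_succ.
(* Every site off the box is joined to [q]. *)
pose q : site d := const_mx B.+1%:Z; exists (c q).
suff far n k : (B < `|n 0%R k|)%N -> c n = c q.
  apply: sub_finite_set (finite_box B) => n /= cn k; rewrite leqNgt; apply/negP=> nk.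
  exact/cn/far/nk.
move=> nk; have [l kl] := other_axis k d2.
pose upd (s : seq 'I_d) : site d := \row_j (if j \in s then B.+1%:Z else n 0 j).
have updc s : k \notin s -> c (upd s) = c n.
  elim: s => [|j s IH]; first by move=> _; congr c; apply/rowP=> j; rewrite mxE.
  rewrite inE negb_or => /andP[kj ks]; rewrite -IH // -(lineD (upd s) k j B.+1%:Z) //.
    by congr c; apply/rowP=> i; rewrite !mxE inE; case: eqP.
  by rewrite mxE (negbTE ks).
rewrite -(updc (enum (predC1 k))); last by rewrite mem_enum inE eqxx.
rewrite -(lineD _ l k B.+1%:Z) ?(eq_sym l) //; last first.
  by rewrite mxE mem_enum inE eq_sym kl; lia.
congr c; apply/rowP=> j; rewrite !mxE mem_enum inE.
by case: eqP.
Qed.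

End Lattice.

(** * Lifting to height functions *)

Lemma Ht_step d (x : site d -> int) n k : Ht x ->
  x (n + axis k) = x n + 1 \/ x (n + axis k) = x n - 1.
Proof. by move=> /(_ _ _ (adjacent_axis n k)); lia. Qed.

(** Both heights change parity at each step, and they agree far away. *)
Lemma Delta_Ht_even d (q : (site d -> int) * (site d -> int)) n :
  (0 < d)%N -> Delta (@Ht d) q -> (2 %| q.2 n - q.1 n)%Z.
Proof.
move=> d0 [Hx Hy fin]; pose k := Ordinal d0.
have [t /contrapT qt] := finite_escape n k fin.
pose c m := (2 %| q.2 m - q.1 m)%Z.
have <- : c (setc n k t) = (2 %| q.2 n - q.1 n)%Z.
  apply: line_const => s; rewrite /c.
  have := Ht_step (setc n k s) k Hx; have := Ht_step (setc n k s) k Hy; lia.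
by rewrite /c qt subrr dvdz0.
Qed.

(** Two height functions whose residues agree off a finite set differ there by a
    multiple of [r] that changes by at most 2 < r between neighbours, hence by a
    constant off a finite set; subtracting this constant from one of them leaves
    its residues unchanged and makes the two agree off a finite set. *)
Lemma lift_spec d r (p : Delta (Xmod d r)) :
  (2 <= d)%N -> (2 < r)%N -> is_lift p (Defs.lift p).
Proof.
move=> d2 r2; have r1 : (1 < r)%N by lia.
suff: is_lift p !=set0 by case=> q; exact: xgetI.
case: p => -[x y] /= xy; have [/= [hx Hx hxE] [hy Hy hyE] fin] := set_mem xy.
have hE n : x n = y n -> (r %| hx n - hy n)%Z.
  by rewrite -hxE -hyE => /intZr_eq; apply.
have [|v vfin] := @const_off_finite d int (fun n => hx n - hy n) _ d2 fin.
  move=> n k /contrapT/hE dn /contrapT/hE dnk.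
  have := dvdz_small (rpredB dnk dn).
  by move: (Ht_step n k Hx) (Ht_step n k Hy); lia.
have d0 : (0 < d)%N by lia.
(* A site off both finite sets shows that [r] divides the constant [v]. *)
have := conj fin vfin; rewrite -finite_setU.
move=> /(finite_escape 0 (Ordinal d0))[t].
set m := setc _ _ _ => /not_orP[/= /contrapT/hE rm /contrapT vm].
exists (hx, fun n => hy n + v); split => //=.
  split => //= [n n' /Hy <-|]; first by congr `|_|; lia.
  by apply: sub_finite_set vfin => n /=; lia.
rewrite -hyE; apply/funext => n; rewrite /phi_mod rmorphD /=.
suff -> : v%:~R = 0 :> 'Z_r by rewrite addr0.
by apply/(intZr_eq v 0 r1); rewrite subr0 -vm.
Qed.

(** * Counting residues *)

Section Count.
Variables (r : nat) (i : nat).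
Hypothesis r1 : (1 < r)%N.

Let class (a b : int) := [set m : int | [/\ a <= m < b,
  (m = a %[mod 2])%Z & (m = i %[mod r])%Z]].

Let class_step a (t : nat) : class a (a + t.+1%:Z * 2) =
  (if (a + t%:Z * 2)%:~R == i%:R :> 'Z_r then [set a + t%:Z * 2] else set0)
    `|` class a (a + t%:Z * 2).
Proof.
have modr m : (m = i %[mod r])%Z <-> m%:~R = i%:R :> 'Z_r.
  have -> : i%:R = i%:Z%:~R :> 'Z_r by [].
  by rewrite intZr_eq // -eqz_mod_dvd; split=> /eqP.
apply/seteqP; split=> m.
  case=> mab ma mi.
  have [mt|mt] := eqVneq m (a + t%:Z * 2).
    by left; move: mi => /modr <-; rewrite mt eqxx.
  by right; split=> //; lia.
move=> [|[mab ma mi]]; last by split=> //; lia.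
by case: eqP => // /modr mi ->; split=> //; lia.
Qed.

Let class_finite a (t : nat) : finite_set (class a (a + t%:Z * 2)).
Proof.
elim: t => [|t IH].
  by rewrite mul0r addr0 (_ : class _ _ = set0) //; apply/seteqP; split => m [] //; lia.
rewrite class_step finite_setU; split => //.
by case: ifP => _; [exact: finite_set1|exact: finite_set0].
Qed.

Lemma Nle0 a : Nle r i a a = 0%N.
Proof.
rewrite /Nle (_ : [set _ | _] = set0) ?fset_set0 ?cardfs0 //.
by apply/seteqP; split => m [] //; lia.
Qed.

Lemma NleS a (t : nat) : Nle r i a (a + t.+1%:Z * 2) =
  (((a + t%:Z * 2)%:~R == i%:R :> 'Z_r) + Nle r i a (a + t%:Z * 2))%N.
Proof.
rewrite /Nle -!/(class _ _) class_step; case: ifP => _; last by rewrite set0U.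
rewrite fset_setU1 // cardfsU1 in_fset_set // memNset //=.
by case; lia.
Qed.
End Count.

(** [Ncount r v a b] counts the steps [m -> m + 2] of a climb from [a] to [b] that
    start at residue [v], so this is a telescoping sum. *)
Lemma sum_Ncount (R : pzRingType) (r : nat) (alpha : 'Z_r -> R) (H : int -> R)
    (a b : int) : (1 < r)%N ->
  (forall m, H (m + 2) - H m = alpha m%:~R) -> (2 %| b - a)%Z ->
  \sum_(v : 'Z_r) alpha v * (Ncount r v a b)%:~R = H b - H a.
Proof.
move=> r1 HS.
have up c (t : nat) : \sum_(v : 'Z_r) alpha v * (Nle r v c (c + t%:Z * 2))%:R =
    H (c + t%:Z * 2) - H c.
  elim: t => [|t IH].
    rewrite mul0r addr0 subrr big1 // => v _.
    by rewrite Nle0 ?mulr0.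
  under eq_bigr => v _ do rewrite NleS // natrD mulrDr.
  rewrite big_split /= IH (bigD1 (c + t%:Z * 2)%:~R) //= natr_Zp eqxx mulr1.
  rewrite big1 => [|v vt]; last by rewrite natr_Zp eq_sym (negbTE vt) mulr0.
  rewrite addr0 -HS addrA; congr (_ - _).
  rewrite subrK; congr H; lia.
move=> ab; rewrite /Ncount; have [leab|ltba] := lerP a b.
  have -> : b = a + (`|((b - a) %/ 2)%Z|%N)%:Z * 2 by lia.
  exact: up.
have -> : a = b + (`|((a - b) %/ 2)%Z|%N)%:Z * 2 by lia.
under eq_bigr => v _ do rewrite rmorphN mulrN.
by rewrite sumrN up opprB.
Qed.

Lemma fsum_seq (R : nmodType) (T : choiceType) (s : seq T) (F : T -> R) :
  uniq s -> (forall i, i \notin s -> F i = 0) ->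
  \sum_(i \in [set: T]) F i = \sum_(i <- s) F i.
Proof.
move=> s_uniq F0; rewrite (fsbigE s) //; last by move=> i _; exact: F0.
by apply: eq_bigl => i; rewrite in_setT.
Qed.

(** A combination of the cocycles [Mcoc] is the total change of a potential [H] of
    heights whose increments over two steps are periodic. *)
Lemma Mcoc_comb_sum (R : realType) (d r : nat) (alpha : 'Z_r -> R)
    (H : int -> R) (p : Delta (Xmod d r)) (E : {fset site d}) :
  (2 <= d)%N -> (2 < r)%N ->
  (forall m, H (m + 2) - H m = alpha m%:~R) ->
  (forall n, (Defs.lift p).1 n <> (Defs.lift p).2 n -> n \in E) ->
  (\sum_(v : 'Z_r) alpha v *: Mcoc d R r v) p =
  \sum_(n <- E) (H ((Defs.lift p).2 n) - H ((Defs.lift p).1 n)).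
Proof.
move=> d2 r2 HS pE; have r1 : (1 < r)%N by lia.
have d0 : (0 < d)%N by lia.
have [Dq _ _] := lift_spec p d2 r2.
have McocE v : Mcoc d R r v p = \sum_(n <- E)
    (Ncount r v ((Defs.lift p).1 n) ((Defs.lift p).2 n))%:~R :> R.
  rewrite /Mcoc (@fsum_seq _ _ E) ?fset_uniq // => n nE.
  have -> : (Defs.lift p).2 n = (Defs.lift p).1 n.
    by apply: contrapT => XY; move/negP: nE; apply; apply: pE => /esym.
  by rewrite /Ncount lexx Nle0.
rewrite fct_sumE.
transitivity (\sum_(v : 'Z_r) \sum_(n <- E) alpha v *
    (Ncount r v ((Defs.lift p).1 n) ((Defs.lift p).2 n))%:~R).
  by apply: eq_bigr => v _; rewrite -mulr_sumr -McocE.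
rewrite exchange_big; apply: eq_bigr => n _.
by apply: sum_Ncount => //; exact: Delta_Ht_even.
Qed.

(** * Patterns on sites and edges *)

Lemma restr_fnd d A (x : site d -> A) W n :
  (restr x W).[? n]%fmap = if n \in W then Some (x n) else None.
Proof.
case: ifP => nW; first by rewrite (in_fnd (f := restr x W) nW) ffunE.
by rewrite not_fnd //= nW.
Qed.

Section Patterns.
Variable d : nat.
Implicit Types (n m : site d) (k l : 'I_d) (W : {fset site d}).

Lemma axis_neq0 k : axis k != 0.
Proof. by apply/eqP=> /rowP/(_ k); rewrite !mxE !eqxx. Qed.

Lemma axisD_neq0 k l : axis k + axis l != 0.
Proof. by apply/eqP=> /rowP/(_ k); rewrite !mxE !eqxx /=; case: eqP. Qed.

Lemma axis_inj : injective (@axis d).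
Proof. by move=> k l /rowP/(_ k); rewrite !mxE !eqxx /=; case: eqP. Qed.

Definition edge k n : {fset site d} := [fset n; (n + axis k)%R]%fset.

Lemma edge_inj k l n m : edge k n = edge l m -> k = l /\ n = m.
Proof.
move=> /fsetP E; have := E n; have := E m.
rewrite !in_fset2 !eqxx /= => /orP nm /esym/orP mn.
have nmE : n = m.
  case: nm mn => [/eqP->//|/eqP mE] [/eqP->//|/eqP nE].
  have : n + (axis k + axis l) == n + 0 by rewrite addrA -mE -nE addr0.
  by rewrite (inj_eq (addrI n)) (negbTE (axisD_neq0 k l)).
split=> //; have := E (n + axis k).
rewrite -nmE !in_fset2 eqxx orbT => /esym/orP[|/eqP/addrI/axis_inj//].
by rewrite -[X in _ == X]addr0 (inj_eq (addrI n)) (negbTE (axis_neq0 k)).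
Qed.

Lemma diam_le1 W n m :
  (diam W <= 1)%N -> n \in W -> m \in W -> n != m -> adjacent n m.
Proof.
move=> dW nW mW nm.
have le1 : (norm1 (n - m) <= 1)%N.
  apply: leq_trans dW; rewrite /diam.
  apply: (@bigmaxn_sup_seq _ _ n) => //.
  exact: (@bigmaxn_sup_seq _ _ m).
have : norm1 (n - m) <> 0%N by move/norm1_eq0/eqP; rewrite subr_eq0 (negbTE nm).
by rewrite /adjacent; lia.
Qed.

Lemma diam_edge k n : (diam (edge k n) <= 1)%N.
Proof.
rewrite /diam; apply/bigmax_leqP_seq => m mW _; apply/bigmax_leqP_seq => p pW _.
have z : norm1 (0 : site d) = 0%N by rewrite /norm1 big1 // => j _; rewrite mxE.
move: mW pW; rewrite !in_fset2 => /orP[]/eqP-> /orP[]/eqP->; rewrite ?subrr ?z //.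
  by rewrite adjacentC //; exact: adjacent_axis.
by rewrite adjacent_axis.
Qed.

(** The lattice graph is bipartite, so it has no triangle. *)
Lemma diam_le1_cases W n : (diam W <= 1)%N -> n \in W ->
  W = [fset n]%fset \/ exists k m, W = edge k m /\ n \in edge k m.
Proof.
move=> dW nW; have adj := diam_le1 dW.
have [Wn|/existsNP[m /not_implyP[mW /eqP mn]]] :=
  pselect (forall m, m \in W -> m = n).
  by left; apply/fsetP => m; rewrite in_fset1; apply/idP/eqP => [/Wn|->].
right.
have Wnm : W = [fset n; m]%fset.
  apply/fsetP => p; rewrite in_fset2; apply/idP/orP => [pW|[]/eqP->//].
  case: (eqVneq p n) => [_|pn]; first by left.
  case: (eqVneq p m) => [_|pm]; first by right.
  have := odd_norm1D (p - m) (m - n); rewrite addrA subrK.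
  by rewrite !adj // 1?eq_sym.
have [k [E|E]] := adjacentP (adj _ _ mW nW mn).
  by exists k, n; rewrite Wnm /edge -E in_fset2 eqxx.
by exists k, m; rewrite Wnm /edge -E fsetUC in_fset2 eqxx orbT.
Qed.

End Patterns.

Section Symbols.
Variables (d : nat) (A : Type) (R : realType) (X : set (site d -> A)).
Variables (phi : language X -> R).
Hypothesis phi_shift : shift_invariant_interaction phi.

Lemma site_symbol : exists f : A -> R,
  forall (a : language X) (n : site d) x, X x ->
    val a = restr x [fset n]%fset -> phi a = f (x n).
Proof.
pose at_site v (a : language X) :=
  exists2 x, X x & exists2 n, val a = restr x [fset n]%fset & x n = v.
have /choice[f fP] v : exists c, forall a, at_site v a -> phi a = c.
  have [[b [y _ [m bE ym]]]|none] := pselect (exists b, at_site v b); last first.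
    by exists 0 => a av; case: none; exists a.
  exists (phi b) => a [x _ [n aE xn]]; apply: (phi_shift (k := m - n)) => p.
  rewrite aE bE !restr_fnd !in_fset1.
  have -> : (p + (m - n) == m) = (p == n).
    by rewrite -(inj_eq (addIr (m - n)) p) [n + _]addrC subrK.
  by case: (p =P n) => [->|_] //; rewrite [n + _]addrC subrK ym xn.
by exists f => a n x Xx aE; apply: fP; exists x => //; exists n.
Qed.

Lemma edge_symbol : exists g : 'I_d -> A -> A -> R,
  forall (a : language X) k (n : site d) x, X x ->
    val a = restr x (edge k n) -> phi a = g k (x n) (x (n + axis k)).
Proof.
pose at_edge k vw (a : language X) := exists2 x, X x & exists2 n,
  val a = restr x (edge k n) & (x n, x (n + axis k)) = vw.
have /choice[g gP] kvw : exists c, forall a, at_edge kvw.1 kvw.2 a -> phi a = c.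
  case: kvw => k vw /=.
  have [[b [y _ [m bE <-]]]|none] := pselect (exists b, at_edge k vw b); last first.
    by exists 0 => a av; case: none; exists a.
  exists (phi b) => a [x _ [n aE [xn xnk]]]; apply: (phi_shift (k := m - n)) => p.
  rewrite aE bE !restr_fnd !in_fset2.
  have nE : (p == n) = (p + (m - n) == m).
    by rewrite -(inj_eq (addIr (m - n))) [n + _]addrC subrK.
  have nkE : (p == n + axis k) = (p + (m - n) == m + axis k).
    by rewrite -(inj_eq (addIr (m - n))) addrAC [n + _]addrC subrK.
  rewrite -nE -nkE; case: (p =P n) => [pn|_] /=.
    by rewrite pn xn [n + _]addrC subrK.
  case: (p =P n + axis k) => [pn|_] //=.
  by rewrite pn xnk addrAC [n + _]addrC subrK.
exists (fun k v w => g (k, (v, w))) => a k n x Xx aE.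
by apply: gP; exists x => //; exists n.
Qed.

End Symbols.

(** * Gibbs cocycles as combinations of residue counts *)

Lemma antidifference2 (R : zmodType) (D : int -> R) :
  exists v : int -> R, forall q, v (q + 2) - v q = D q.
Proof.
(* Even and odd arguments are independent: on residue [b] put q = 2 t + b and sum
   from t = 0, in both directions. *)
pose w (b : int) (t : int) : R := match t with
  | Posz n => \sum_(i < n) D (i%:Z * 2 + b)
  | Negz n => - \sum_(i < n.+1) D (- i.+1%:Z * 2 + b)
  end.
have wS b t : w b (t + 1) - w b t = D (t * 2 + b).
  case: t => [n|[|n]].
  - have -> : n%:Z + 1 = n.+1%:Z by lia.
    by rewrite /w big_ord_recr /= addrAC subrr add0r.
  - have -> : Negz 0 + 1 = 0%:Z by lia.
    rewrite /w big_ord0 big_ord_recr /= big_ord0 !add0r opprK.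
    by congr D; lia.
  - have -> : Negz n.+1 + 1 = Negz n by lia.
    rewrite /w [in X in _ - X]big_ord_recr /= opprK addrA addNr add0r.
    by congr D; lia.
exists (fun q => w (q %% 2)%Z (q %/ 2)%Z) => q.
rewrite (_ : ((q + 2) %% 2)%Z = (q %% 2)%Z); last by lia.
rewrite (_ : ((q + 2) %/ 2)%Z = (q %/ 2)%Z + 1) ?wS; last by lia.
by congr D; lia.
Qed.

(** The pairs of neighbouring heights, with the first entry marked as a left
    vertex and the second as a right vertex, form a bipartite graph that is a
    union of two infinite paths.  Having no cycle, it imposes no compatibility
    condition on potentials [u] and [v].  Over residues there would be one,
    around each cycle, which is why one works with heights. *)
Lemma height_split (R : zmodType) (g : int -> int -> R) :
  exists u v : int -> R, forall a b, `|a - b| = 1 -> g a b = u a + v b.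
Proof.
have [v vS] := antidifference2 (fun q => g (q + 1) (q + 2) - g (q + 1) q).
exists (fun a => g a (a + 1) - v (a + 1)), v => a b ab.
have [->|->] : b = a + 1 \/ b = a - 1 by lia.
  by rewrite subrK.
have {vS} := vS (a - 1); have -> : a - 1 + 1 = a by lia.
have -> : a - 1 + 2 = a + 1 by lia.
by move=> /(canRL (subrK _)) ->; rewrite opprD addrA subrK opprB addrC subrK.
Qed.

Section GibbsSum.
Variables (d : nat) (A : Type) (R : realType) (X : set (site d -> A)).
Variables (phi : language X -> R) (p : Delta X).
Hypothesis phi_nn : nearest_neighbor phi.
Let G W : R := phi (pattern_snd p W) - phi (pattern_fst p W).

Let G_eq0 W : (forall n, n \in W -> (val p).1 n = (val p).2 n) -> G W = 0.
Proof.
move=> pW; rewrite /G (_ : pattern_snd p W = pattern_fst p W) ?subrr //.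
by apply/val_inj/fmapP => n /=; rewrite !restr_fnd; case: ifP => // /pW->.
Qed.

(** A pattern on a set of diameter greater than 1 has no energy, and one on a set
    where the two configurations agree cancels. *)
Lemma gibbs_cocycle_sum (E : {fset site d}) :
  (forall n, (val p).1 n <> (val p).2 n ->
     n \in E /\ forall k m, n = m + axis k -> m \in E) ->
  gibbs_cocycle phi p = \sum_(n <- E)
    (phi (pattern_snd p [fset n]%fset) - phi (pattern_fst p [fset n]%fset)) +
    \sum_(k < d) \sum_(n <- E)
      (phi (pattern_snd p (edge k n)) - phi (pattern_fst p (edge k n))).
Proof.
move=> pE; rewrite /gibbs_cocycle.
pose s1 := [seq [fset n]%fset | n <- E].
pose s2 := [seq edge k n | k <- enum 'I_d, n <- (E : seq (site d))].
rewrite (@fsum_seq _ _ (s1 ++ s2) G).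
- rewrite big_cat /= big_map big_allpairs_dep big_enum_cond /=.
  by congr (_ + _).
- rewrite cat_uniq; apply/and3P; split.
  + by rewrite map_inj_uniq ?fset_uniq // => n m /fset1_inj.
  + apply/hasPn => W /allpairsP[[k n] [_ _ ->]] /=.
    apply/mapP => -[m _ /(congr1 (fun F : {fset _} => #|` F|%fset))].
    rewrite cardfs1 cardfs2 -[X in X != _]addr0 (inj_eq (addrI n)).
    by rewrite eq_sym axis_neq0.
  + apply: allpairs_uniq; rewrite ?enum_uniq ?fset_uniq //.
    by move=> [k n] [l m] _ _ /edge_inj[/= -> ->].
- move=> W; rewrite mem_cat negb_or => /andP[W1 W2].
  have [W_far|W_near] := ltnP 1 (diam W).
    by rewrite /G !phi_nn ?subrr.
  apply: G_eq0 => n nW; apply: contrapT => pn; have [nE mE] := pE n pn.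
  case: (diam_le1_cases W_near nW) => [WE|[k [m [WE nk]]]].
    by move/mapP: W1; apply; exists n.
  move/allpairsP: W2; apply; exists (k, m); split; rewrite ?mem_enum //=.
  by move: nk; rewrite in_fset2 => /orP[/eqP<-//|/eqP/mE].
Qed.

End GibbsSum.

(** A box around [D], enlarged by one, serves as a common range of summation for
    sites and for edges, the latter indexed by their first endpoint. *)
Lemma finite_halo d (D : set (site d)) : finite_set D ->
  exists E : {fset site d}, forall n, D n ->
    n \in E /\ forall k m, n = m + axis k -> m \in E.
Proof.
move=> /finite_bounded[B DB]; have box := @finite_box d B.+1.
exists (fset_set [set n : site d | forall k, (`|n 0%R k| <= B.+1)%N]) => n nD.
split=> [|k m nm]; rewrite in_fset_set // inE => l /=; have := DB n nD l.
  by lia.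
by rewrite nm !mxE eqxx /=; case: (l == k) => /=; lia.
Qed.

Section GibbsHeights.
Variables (d r : nat) (R : realType) (phi : language (Xmod d r) -> R).
Variables (f : 'Z_r -> R) (g : 'I_d -> 'Z_r -> 'Z_r -> R).
Hypotheses (d2 : (2 <= d)%N) (r2 : (2 < r)%N) (phi_nn : nearest_neighbor phi).
Hypothesis phi_site : forall (a : language (Xmod d r)) (n : site d) x, Xmod d r x ->
  val a = restr x [fset n]%fset -> phi a = f (x n).
Hypothesis phi_edge : forall (a : language (Xmod d r)) k (n : site d) x, Xmod d r x ->
  val a = restr x (edge k n) -> phi a = g k (x n) (x (n + axis k)).

(** The change in energy when one site is raised from [v] to [v + 2], its
    neighbours being all at [v + 1], for symbol energies [f] and edge energies
    [g]; the two edges along axis [k] contribute separately. *)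
Definition flip_energy (v : 'Z_r) : R := f (v + 2%:R) - f v +
  \sum_(k < d) (g k (v + 1) (v + 2%:R) - g k v (v + 1) +
                (g k (v + 2%:R) (v + 1) - g k (v + 1) v)).

(** Every term of [flip_energy] is a difference of a function of [v] and its
    translate by 1 or 2. *)
Lemma sum_flip_energy : \sum_v flip_energy v = 0.
Proof.
have shift1 (h : 'Z_r -> R) c : \sum_v h (v + c) = \sum_v h v.
  by rewrite [RHS](reindex_inj (addIr c)).
rewrite big_split /= sumrB shift1 subrr add0r exchange_big big1 // => k _ /=.
rewrite big_split /= !sumrB.
rewrite -(shift1 (fun v => g k v (v + 1)) 1) -(shift1 (fun v => g k (v + 1) v) 1).
under eq_bigr => v _ do rewrite (_ : v + 2%:R = v + 1 + 1) ?addrA //.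
under [X in _ + (X - _)]eq_bigr => v _ do rewrite (_ : v + 2%:R = v + 1 + 1) ?addrA //.
by rewrite !subrr addr0.
Qed.

(** On heights an edge energy splits into a term for each endpoint; regrouping
    the terms by sites turns the energy into a sum over sites of a single potential
    [H], which need not be periodic but has the periodic two-step increments
    [flip_energy]. *)
Lemma gibbs_cocycle_Mcoc :
  gibbs_cocycle phi = \sum_(v : 'Z_r) flip_energy v *: Mcoc d R r v.
Proof.
apply/funext => p; have [[HtX HtY fin] Xp Yp] := lift_spec p d2 r2.
set X := (Defs.lift p).1 in HtX Xp fin *; set Y := (Defs.lift p).2 in HtY Yp fin *.
have /choice[uv uvP] : forall k, exists w : (int -> R) * (int -> R),
    forall a b : int, `|a - b| = 1 -> g k a%:~R b%:~R = w.1 a + w.2 b.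
  move=> k; have [u [v uvE]] := height_split (fun a b : int => g k a%:~R b%:~R).
  by exists (u, v).
pose u k := (uv k).1; pose v k := (uv k).2.
pose H (h : int) := f h%:~R + \sum_(k < d) (u k h + v k h).
have HS m : H (m + 2) - H m = flip_energy m%:~R.
  rewrite /H /flip_energy opprD addrACA -sumrB rmorphD /=.
  congr (_ - _ + _); apply: eq_bigr => k _.
  have E1 : m%:~R + 1 = (m + 1)%:~R :> 'Z_r by rewrite rmorphD.
  have E2 : m%:~R + 2%:R = (m + 2)%:~R :> 'Z_r by rewrite rmorphD.
  rewrite E1 E2 !uvP -/(u k) -/(v k); try by lia.
  ring.
have [E EP] := finite_halo fin.
have off n : n \notin E -> X n = Y n.
  by move=> /negP nE; apply: contrapT => /(EP n)[/nE].
have off_axis k n : n \notin E -> X (n + axis k) = Y (n + axis k).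
  by move=> /negP nE; apply: contrapT => /(EP _)[_ /(_ k n erefl)/nE].
rewrite (Mcoc_comb_sum (E := E) d2 r2 HS); last by move=> n /EP[].
have mem_p n : (val p).1 n <> (val p).2 n -> X n <> Y n.
  by rewrite -Xp -Yp /phi_mod => pn XY; apply: pn; rewrite XY.
rewrite (gibbs_cocycle_sum phi_nn (E := E)); last by move=> n /mem_p/EP.
have XpX := Delta_fst p; have XpY := Delta_snd p.
under eq_bigr => n _.
  rewrite (@phi_site (pattern_snd p _) n _ XpY (erefl _))
    (@phi_site (pattern_fst p _) n _ XpX (erefl _)) -Xp -Yp /phi_mod.
  over.
have step (Z : site d -> int) k n : Ht Z -> `|Z n - Z (n + axis k)| = 1.
  by move=> HtZ; apply: HtZ; exact/adjacentC/adjacent_axis.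
have edgeE k : \sum_(n <- E)
    (phi (pattern_snd p (edge k n)) - phi (pattern_fst p (edge k n))) =
    \sum_(n <- E) ((u k (Y n) + v k (Y n)) - (u k (X n) + v k (X n))).
  pose V n := v k (Y n) - v k (X n).
  transitivity (\sum_(n <- E) (u k (Y n) - u k (X n) + V (n + axis k))).
    apply: eq_bigr => n _.
    rewrite (@phi_edge (pattern_snd p _) k n _ XpY (erefl _))
      (@phi_edge (pattern_fst p _) k n _ XpX (erefl _)) -Xp -Yp /phi_mod.
    by rewrite !uvP ?step // -/(u k) -/(v k) /V; ring.
  have V0 n : n \notin E -> V n = 0.
    by move=> /off XY; rewrite /V XY subrr.
  have Vshift : \sum_(n <- E) V (n + axis k) = \sum_(n <- E) V n.
    have V0' n : n \notin E -> V (n + axis k) = 0.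
      by move=> /(off_axis k) XY; rewrite /V XY subrr.
    rewrite -(fsum_seq (fset_uniq E) V0) -(fsum_seq (fset_uniq E) V0').
    rewrite [RHS](reindex_fsbigT (fun n => n + axis k)) //.
    by exists (fun n => n - axis k) => n; rewrite ?addrK ?subrK.
  rewrite big_split /= Vshift -big_split; apply: eq_bigr => n _ /=.
  by rewrite /V; ring.
under [X in _ + X]eq_bigr => k _ do rewrite edgeE.
rewrite exchange_big -big_split; apply: eq_bigr => n _ /=.
by rewrite /H sumrB; ring.
Qed.

End GibbsHeights.

(** * An interaction with prescribed flip energies *)

Section Ascent.
Variables (d r : nat) (R : realType) (X : set (site d -> 'Z_r)).
Variables (k : 'I_d) (s : 'Z_r -> R).

(** The pattern lives on a single edge along axis [k] and rises there from [v] to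
    [v + 1].  The base point is quantified, so that translation invariance is
    built in. *)
Definition ascends (a : {fmap site d -> 'Z_r}) (v : 'Z_r) : Prop := exists n,
  [/\ a.[? n]%fmap = Some v, a.[? (n + axis k)%R]%fmap = Some (v + 1) &
      forall m, a.[? m]%fmap <> None -> m = n \/ m = n + axis k].

(** Summing over all [v] avoids choosing the base point; at most one term is
    nonzero. *)
Definition ascent_interaction (a : language X) : R :=
  \sum_(v : 'Z_r) if `[< ascends (val a) v >] then s v else 0.

Lemma ascends_restr x W v : ascends (restr x W) v <->
  exists n, [/\ W = edge k n, x n = v & x (n + axis k) = v + 1].
Proof.
split=> [[n []]|[n [-> xn xnk]]].
  rewrite !restr_fnd; case: ifP => // nW [xn]; case: ifP => // nkW [xnk] Wn.
  exists n; split=> //; apply/fsetP => m; rewrite in_fset2.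
  apply/idP/orP => [mW|[]/eqP->//].
  have [|->|->] := Wn m; first by rewrite restr_fnd mW.
    by left.
  by right.
exists n; rewrite !restr_fnd !in_fset2 !eqxx orbT xn xnk; split=> // m.
by rewrite restr_fnd in_fset2; case: eqP => [|_]; [left|case: eqP; [right|]].
Qed.

Lemma ascent_nearest_neighbor : nearest_neighbor ascent_interaction.
Proof.
move=> a; have [x _ [W aE]] := set_mem (valP a); rewrite /ascent_interaction.
rewrite aE /= => W_far; rewrite big1 // => v _; case: asboolP => //.
move=> /ascends_restr[n [WE _ _]].
by move: W_far; rewrite WE ltnNge diam_edge.
Qed.

Lemma ascent_shift_invariant : shift_invariant_interaction ascent_interaction.
Proof.
move=> m a b ab; apply: eq_bigr => v _.
rewrite (_ : `[< _ >] = `[< ascends (val a) v >]) //.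
apply/asbool_equiv_eq; split=> -[n [nv nkv dom]].
  exists (n + m); rewrite addrAC -!ab; split=> // p.
  rewrite -[p](subrK m) -ab => /dom[->|->]; [by left|by right; rewrite addrAC].
exists (n - m); rewrite !ab [n - m + axis k + m]addrAC subrK; split=> // p.
rewrite ab => /dom[/(canRL (addrK _))->|/(canRL (addrK _))->]; [by left|right].
by rewrite addrAC.
Qed.

Lemma ascent_site (a : language X) (n : site d) x :
  val a = restr x [fset n]%fset -> ascent_interaction a = 0.
Proof.
move=> aE; apply: big1 => v _; case: asboolP => //.
rewrite aE => /ascends_restr[m [E _ _]].
have := congr1 (fun F : {fset site d} => #|` F|%fset) E.
rewrite cardfs1 cardfs2 -[X in X != _]addr0 (inj_eq (addrI m)).
by rewrite eq_sym axis_neq0.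
Qed.

Lemma ascent_edge (a : language X) l (n : site d) x :
  val a = restr x (edge l n) ->
  ascent_interaction a =
  if (l == k) && (x (n + axis l) == x n + 1) then s (x n) else 0.
Proof.
move=> aE; rewrite /ascent_interaction (bigD1 (x n)) //= big1 => [|v vx].
  rewrite addr0 (_ : `[< _ >] = (l == k) && (x (n + axis l) == x n + 1)) //.
  rewrite aE; apply/asboolP/andP.
    by move=> /ascends_restr[m [/edge_inj[-> ->] _ ->]]; rewrite !eqxx.
  by move=> [/eqP lk /eqP xn]; apply/ascends_restr; exists n; rewrite -lk.
case: asboolP => //; rewrite aE => /ascends_restr[m [/edge_inj[_ <-] xn _]].
by rewrite xn eqxx in vx.
Qed.

End Ascent.

(** Partial sums from 0; the vanishing of the total is the condition for the step
    from [r - 1] back to 0. *)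
Lemma cyclic_primitive (r : nat) (R : zmodType) (alpha : 'Z_r -> R) :
  \sum_v alpha v = 0 -> exists s : 'Z_r -> R, forall v, s (v + 1) - s v = alpha v.
Proof.
move=> alpha0; exists (fun v => \sum_(j : 'Z_r | (j < v)%N) alpha j) => v.
have [v_max|v_lt] := eqVneq (v : nat) (Zp_trunc r).+1.
  rewrite [X in X - _]big1 => [|j]; last first.
    by rewrite /= v_max modnDmr addn1 modnn.
  move: alpha0; rewrite (bigD1 v) //= => /eqP; rewrite addr_eq0 => /eqP ->.
  rewrite sub0r; congr (- _); apply: eq_bigl => j.
  by rewrite -val_eqE /= v_max; have := ltn_ord j; lia.
have vS : (v + 1 : 'Z_r) = v.+1 :> nat.
  by rewrite /= modnDmr addn1 modn_small //; have := ltn_ord v; lia.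
rewrite (bigD1 v) ?vS //; apply/eqP; rewrite subr_eq; apply/eqP; congr (_ + _).
by apply: eq_bigl => j; rewrite -val_eqE /=; lia.
Qed.

(** For the converse inclusion, energy [s v] on the edges of one axis that rise from
    [v] to [v + 1] gives flip energy [s (v + 1) - s v], and any weights with zero
    sum have this form. *)
Lemma Gsigma_Mcoc (R : realType) (d r : nat) : (2 <= d)%N -> (2 < r)%N ->
  Gsigma R (Xmod d r) = [set \sum_(v : 'Z_r) alpha v *: Mcoc d R r v
    | alpha in [set alpha : 'Z_r -> R | \sum_v alpha v = 0]].
Proof.
move=> d2 r2; apply/seteqP; split=> [M [phi [phi_nn phi_shift] <-]|].
  have [f fP] := site_symbol phi_shift; have [g gP] := edge_symbol phi_shift.
  exists (flip_energy f g); first exact: sum_flip_energy.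
  by rewrite (gibbs_cocycle_Mcoc d2 r2 phi_nn fP gP).
move=> _ [alpha /= alpha0 <-]; have [s sP] := cyclic_primitive alpha0.
have d0 : (0 < d)%N by lia.
pose k0 := Ordinal d0.
pose g l (v w : 'Z_r) : R := if (l == k0) && (w == v + 1) then s v else 0.
exists (@ascent_interaction d r R (Xmod d r) k0 s).
  by split; [exact: ascent_nearest_neighbor|exact: ascent_shift_invariant].
rewrite (@gibbs_cocycle_Mcoc _ _ _ _ (fun=> 0) g) //; first last.
- by move=> a k n x _; exact: ascent_edge.
- by move=> a n x _; exact: ascent_site.
- exact: ascent_nearest_neighbor.
apply: eq_bigr => v _; congr (_ *: _).
rewrite /flip_energy subrr add0r (bigD1 k0) //= big1 => [|k kk0].
  have two : v + 2%:R = v + 1 + 1 by rewrite -addrA.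
  (* A descending edge does not also count as ascending: 2 is not 0 in 'Z_r. *)
  have neq (w : 'Z_r) : (w == w + 1 + 1) = false.
    rewrite -addrA -[X in X == _]addr0 (inj_eq (addrI w)).
    by rewrite eq_sym (natZr_eq0 2) ?gtnNdvd //; lia.
  rewrite /g two !eqxx /= -two two !neq subrr !addr0; exact: sP.
by rewrite /g (negbTE kk0) /= !subrr addr0.
Qed.

(** * Flip pairs and dimension *)

(** The lift of a flip pair also differs at the origin only: elsewhere the
    difference is a multiple of [r], constant along any line that avoids the
    origin, and zero far away.  At the origin it is 0 or 2 or -2 and congruent to
    2, hence equal to 2; the case -2 would need r = 4. *)
Lemma Mcoc_flip (R : realType) (d r : nat) (j : nat) (p : Delta (Xmod d r))
    (v : 'Z_r) : (2 <= d)%N -> (2 < r)%N -> r != 4%N -> is_flip_pair j p ->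
  Mcoc d R r v p = (v == j%:R)%:R.
Proof.
move=> d2 r2 r4 [p1 p2 poff]; have r1 : (1 < r)%N by lia.
have [[HtX HtY fin] Xp Yp] := lift_spec p d2 r2; rewrite /Mcoc.
set X := (Defs.lift p).1 in HtX Xp fin *; set Y := (Defs.lift p).2 in HtY Yp fin *.
have XYmod n : n != 0 -> (r %| Y n - X n)%Z.
  move=> n0; apply/(intZr_eq _ _ r1).
  by have := poff n n0; rewrite -Xp -Yp.
have nonzero (n : site d) : n != 0 -> exists k, n 0 k != 0.
  move=> n0; apply: contrapT => nk; move/eqP: n0; apply; apply/rowP=> k.
  by rewrite mxE; apply: contrapT => nk0; apply: nk; exists k; apply/eqP.
have XY n : n != 0 -> X n = Y n.
  move=> /nonzero[k nk]; have [l kl] := other_axis k d2.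
  have off t : setc n l t != 0.
    by apply/eqP=> /rowP/(_ k); rewrite !mxE (negbTE kl); apply/eqP.
  have [t] := finite_escape n l fin => /= /contrapT XYt.
  suff : Y (setc n l t) - X (setc n l t) = Y n - X n by rewrite XYt; lia.
  apply: (line_const (c := fun m : site d => Y m - X m)) => u.
  have := dvdz_small (rpredB (XYmod _ (off (u + 1))) (XYmod _ (off u))).
  rewrite setc_succ.
  by move: (Ht_step (setc n l u) l HtX) (Ht_step (setc n l u) l HtY); lia.
have Y0 : Y 0 = X 0 + 2.
  have d0 : (0 < d)%N by lia.
  have e0 := axis_neq0 (Ordinal d0).
  have : (r %| Y 0%R - X 0%R - 2)%Z.
    apply/(intZr_eq (Y 0 - X 0) 2 r1); rewrite rmorphB /=.
    move: p1 p2; rewrite -Xp -Yp /phi_mod natrD => -> ->.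
    by rewrite addrAC subrr add0r.
  have hX := Ht_step 0 (Ordinal d0) HtX; have hY := Ht_step 0 (Ordinal d0) HtY.
  move: (XY _ e0) hX hY.
  rewrite !add0r => -> hX hY.
  have [|[|]] : Y 0 - X 0 - 2 = 0 \/ Y 0 - X 0 - 2 = - 2%:Z \/
      Y 0 - X 0 - 2 = - 4%:Z.
  - by move: hX hY; lia.
  - by lia.
  - by move=> -> /dvdz_small/(_ r2).
  - move=> ->; rewrite dvdzE /= => r_dvd4; have r_le4 := dvdn_leq (ltn0Sn 3) r_dvd4.
    have r3 : r = 3%N by lia.
    by rewrite r3 in r_dvd4.
have v0 : (X 0)%:~R = j%:R :> 'Z_r by rewrite -p1 -Xp.
rewrite (@fsum_seq _ _ [:: 0]) //.
  rewrite big_seq1 Y0 /Ncount (_ : X 0 <= X 0 + 2); last by lia.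
  have -> : X 0 + 2 = X 0 + 1%:Z * 2 by lia.
  rewrite NleS // mul0r addr0 Nle0 // addn0 v0 natr_Zp eq_sym.
  by [].
move=> n; rewrite inE => /XY <-; by rewrite /Ncount lexx Nle0.
Qed.

(** A basis is given by the [m j - m ord_max] for [j] other than [ord_max]. *)
Lemma has_dim_zero_sum (K : fieldType) (V : lmodType K) (n : nat)
    (m : 'I_n.+1 -> V) :
  (forall c : 'I_n.+1 -> K, \sum_j c j *: m j = 0 -> forall j, c j = 0) ->
  has_dim [set \sum_j c j *: m j | c in [set c : 'I_n.+1 -> K | \sum_j c j = 0]] n.
Proof.
move=> m_free; pose w : 'I_n -> 'I_n.+1 := widen_ord (leqnSn n).
exists (fun j => m (w j) - m ord_max).
pose ext (c : 'I_n -> K) (j : 'I_n.+1) : K :=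
  if unlift ord_max j is Some i then c i else - \sum_i c i.
have wE j : w j = lift ord_max j.
  by apply: val_inj; rewrite /= /bump leqNgt ltn_ord.
have extE c : \sum_(j < n) c j *: (m (w j) - m ord_max) = \sum_j ext c j *: m j.
  rewrite big_ord_recr /= {2}/ext unlift_none scaleNr scaler_suml -sumrB.
  by apply: eq_bigr => j _; rewrite -/(w j) /ext wE liftK scalerBr.
split=> [c c0 j|].
  have := m_free (ext c) _ (w j); rewrite /ext wE liftK; apply.
  by rewrite -extE.
apply/seteqP; split=> _ [c c0 <-].
  exists (c \o w) => //; rewrite extE; apply: eq_bigr => j _; congr (_ *: _).
  rewrite /ext; case: unliftP => [i ->|->] /=; first by rewrite wE.
  by move/eqP: c0; rewrite big_ord_recr /= addrC addr_eq0 => /eqP ->.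
exists (ext c); rewrite ?extE //= big_ord_recr /= {2}/ext unlift_none.
apply/eqP; rewrite subr_eq0; apply/eqP/eq_bigr => j _.
by rewrite -/(w j) wE /ext liftK.
Qed.

Theorem proposition5p3 (R : realType) (d r : nat)
    (hd : (2 <= d)%N) (hr0 : (0 < r)%N) (hr : r \notin [:: 1; 2; 4]%N) :
  [/\ forall flip : 'I_r -> Delta (Xmod d r),
      (forall i : 'I_r, is_flip_pair i (flip i)) ->
      forall M : Delta (Xmod d r) -> R^o,
      shift_invariant_markov_cocycle M ->
        (Gsigma R (Xmod d r) M <->
        exists alpha : 'I_r -> R,
          [/\ forall i, alpha i = M (flip i),
              \sum_(i < r) alpha i = 0 &
              M = \sum_(i < r) alpha i *: Mcoc d R r i]),
      Gsigma R (Xmod d r) =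
        [set \sum_(i < r) alpha i *: Mcoc d R r i
          | alpha in [set alpha : 'I_r -> R | \sum_(i < r) alpha i = 0]] &
      has_dim (Gsigma R (Xmod d r)) r.-1].
Proof.
have r2 : (2 < r)%N by move: hr0 hr; rewrite !inE; lia.
have r4 : r != 4%N by move: hr; rewrite !inE; lia.
(* Once r is a successor of 2, the types 'I_r and 'Z_r are convertible. *)
case: r hr0 hr r2 r4 => [|[|[|r]]] // _ _ r2 r4.
have GE := Gsigma_Mcoc R hd r2; set n := r.+3 in r2 r4 GE *.
have comb_flip (alpha : 'I_n -> R) (j : 'I_n) (p : Delta (Xmod d n)) :
    is_flip_pair j p -> (\sum_(i < n) alpha i *: Mcoc d R n i) p = alpha j.
  move=> jp; rewrite fct_sumE (bigD1 j) //= big1 => [|i ij].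
    rewrite /GRing.scale /= (Mcoc_flip R _ hd r2 r4 jp) natr_Zp eqxx addr0.
    exact: mulr1.
  rewrite /GRing.scale /= (Mcoc_flip R _ hd r2 r4 jp) natr_Zp (negbTE ij).
  exact: mulr0.
split=> [flip flipP M _| |]; last 2 first.
- exact: GE.
- rewrite GE; apply: has_dim_zero_sum => c c0 j.
  have [p jp] := flip_pair_exists d n j.
  by rewrite -(comb_flip c j p jp) c0.
rewrite GE; split=> [[alpha /= alpha0 ME]|[alpha [_ alpha0 ->]]].
  exists alpha; split=> // i.
  by rewrite -ME (comb_flip alpha i).
by exists alpha.
Qed.
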